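(* Let $G$ be a finite abelian group with exponent $n\ge 2$ and let $A=[1,n-1]=\{1,2,\ldots,n-1\}$. Then $G$ is $0$-complete with respect to $A$; that is, every finite sequence $S$ over $G$ satisfies $$N_{A,0}(S)\geq 2^{|S|-D_A(G)+1}.$$
   Context: $G$ is written additively. A sequence over $G$ is a finite sequence $S=\prod_{i=1}^m g_i$ of elements of $G$ (repetition allowed, order irrelevant, i.e. an element of the free abelian monoid $\mathcal F(G)$ with basis $G$); $|S|=m$ is its length, and the empty sequence is allowed. Subsequences are identified by their index sets $I\subseteq[1,m]$. For a nonempty set $A$ of integers, none divisible by $n$, and $g\in G$, $N_{A,g}(S)$ is the number of index sets $I\subseteq [1,m]$ (including $I=\emptyset$, whose sum is by convention $0$) for which there exist $a_i\in A$ ($i\in I$) with $\sum_{i\in I}a_ig_i=g$. The $A$-weighted Davenport constant $D_A(G)$ is the smallest positive integer $l$ such that for every sequence $S=g_1\cdots g_t$ over $G$ of length $t\ge l$ there are a nonempty $I\subseteq[1,t]$ and $a_i\in A$ ($i\in I$) with $\sum_{i\in I}a_ig_i=0$. A group $G$ is $0$-complete with respect to $A$ if $N_{A,0}(S)\geq 2^{|S|-D_A(G)+1}$ for all $S\in\mathcal F(G)$. *)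

(* Defs.v *)
From mathcomp Require Import all_boot all_order all_algebra all_fingroup all_solvable.
From mathcomp Require Import boolp.

Set Implicit Arguments.
Unset Strict Implicit.
Unset Printing Implicit Defensive.

Import Order.TTheory GRing.Theory Num.Theory.

Local Open Scope ring_scope.

(* A sequence over G is represented by a list, whose ordering plays no role in
   the notions below; its subsequences are given by their index sets. *)

Definition is_weighted_sum (G : finZmodType) (A : {pred int}) (S : seq G)
    (I : {set 'I_(size S)}) (g : G) : Prop :=
  exists2 a : 'I_(size S) -> int,
    forall i, i \in I -> a i \in A & \sum_(i in I) S`_i *~ a i = g.

Definition weighted_count (G : finZmodType) (A : {pred int}) (g : G)
    (S : seq G) : nat :=
  #|[set I : {set 'I_(size S)} | `[< is_weighted_sum A I g >]]|.

Definition davenport_bound (G : finZmodType) (A : {pred int}) (l : nat) : Prop :=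
  (0 < l)%N /\
  forall S : seq G, (l <= size S)%N ->
    exists2 I : {set 'I_(size S)}, I != set0 & is_weighted_sum A I 0.

(* The default value 0 is only taken when A is empty, see davenportP. *)
Definition davenport (G : finZmodType) (A : {pred int}) : nat :=
  if pselect (exists l, `[< davenport_bound G A l >]) is left exl
  then ex_minn exl else 0%N.

(* The exponent of 2 is an integer, possibly negative, so that the power is
   taken in rat. *)
Definition zero_complete (G : finZmodType) (A : {pred int}) : Prop :=
  forall S : seq G,
    (2 : rat) ^ ((size S)%:Z - (davenport G A)%:Z + 1)
      <= (weighted_count A 0 S)%:R.

Lemma davenport_bound_card (G : finZmodType) (A : {pred int}) (a : int) :
  a \in A -> davenport_bound G A #|G|.
Proof.
move=> aA; split; first by apply/card_gt0P; exists 0.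
move=> S leGS.
pose f (k : 'I_(size S).+1) : G := \sum_(i < size S | (i < k)%N) S`_i.
have /injectivePn[j0 [k0 ne_jk eq_f]] : ~~ injectiveb f.
  by apply/negP => /injectiveP/leq_card; rewrite card_ord leqNgt ltnS leGS.
wlog lt_jk : j0 k0 ne_jk eq_f / (j0 < k0)%N.
  move=> th; case: (ltngtP j0 k0) => [lt|lt|/val_inj e].
  - exact: (th j0 k0).
  - by apply: (th k0 j0) => //; rewrite eq_sym.
  - by rewrite e eqxx in ne_jk.
exists [set i : 'I_(size S) | (j0 <= i < k0)%N].
  have lt_jS : (j0 < size S)%N by rewrite (leq_trans lt_jk) // -ltnS ltn_ord.
  by apply/set0Pn; exists (Ordinal lt_jS); rewrite inE /= leqnn.
exists (fun=> a) => //; rewrite -mulrz_suml.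
suff -> : \sum_(i in [set i : 'I_(size S) | (j0 <= i < k0)%N]) S`_i = 0.
  by rewrite mul0rz.
apply: (@addrI _ (f j0)); rewrite addr0 [RHS]eq_f /f.
rewrite [RHS](bigID (fun i : 'I_(size S) => (i < j0)%N)) /=.
congr (_ + _); apply: eq_bigl => i.
  by case: (ltnP i j0) => [/ltn_trans -> //|]; rewrite andbF.
by rewrite inE -leqNgt andbC.
Qed.

Lemma davenportP (G : finZmodType) (A : {pred int}) (a : int) :
  a \in A ->
  davenport_bound G A (davenport G A) /\
  forall l, davenport_bound G A l -> (davenport G A <= l)%N.
Proof.
move=> aA; rewrite /davenport; case: pselect => [exl|[]].
  by case: ex_minnP => m /asboolP bm minm; split=> // l /asboolP; apply: minm.
by exists #|G|; apply/asboolP; apply: davenport_bound_card aA.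
Qed.

(* Main.v *)
Require Import Defs.
From mathcomp Require Import all_boot all_order all_algebra all_fingroup all_solvable.
From mathcomp Require Import boolp.
Import Order.TTheory GRing.Theory Num.Theory.
Local Open Scope ring_scope.

(* Call an index set independent if no nonempty subset of it admits a weighted
   zero-sum, and let B be a maximal independent index set of S.  By definition
   of D_A(G), |B| < D_A(G).  By maximality, every j outside B carries an integer
   relation c_j supported in B and j with n not dividing its j-th coefficient.
   For each set T of indices outside B, the coefficients of the sum of the c_j
   (j in T) not divisible by n then form an index set which meets the complement
   of B exactly in T, and reducing them modulo n puts them in [1, n-1].  So there
   are at least 2^(|S| - |B|) weighted zero-sum index sets. *)

Definition independent (G : finZmodType) (A : {pred int}) (S : seq G)
    (B : {set 'I_(size S)}) : Prop :=
  forall I : {set 'I_(size S)}, I \subset B -> I != set0 ->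
    ~ is_weighted_sum A I 0.

Lemma independent0 (G : finZmodType) (A : {pred int}) (S : seq G) :
  independent G A S set0.
Proof. by move=> I; rewrite subset0 => ->. Qed.

(** If [B] had at least [l] elements, listing its terms would give a sequence [S'] long enough for
    the bound. Its weighted zero-sum, carried back along the injection [f] of positions, contradicts
    independence. *)
Lemma independent_card_lt (G : finZmodType) (A : {pred int}) (S : seq G)
    (B : {set 'I_(size S)}) (l : nat) :
  davenport_bound G A l -> independent G A S B -> (#|B| < l)%N.
Proof.
move=> [_ bl] indB; rewrite ltnNge; apply/negP => leB.
pose S' : seq G := [seq S`_(val i) | i <- enum B].
have sz : size S' = #|B| by rewrite size_map -cardE.
have [|I nI [a aA sa]] := bl S'; first by rewrite sz.
pose f (k : 'I_(size S')) : 'I_(size S) := enum_val (cast_ord sz k).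
have fI : injective f by move=> x y /enum_val_inj /cast_ord_inj.
have S'E (k : 'I_(size S')) : S'`_k = S`_(f k).
  have kB : (k < size (enum B))%N by rewrite -cardE -sz.
  by rewrite (nth_map (f k)) // {2}/f (enum_val_nth (f k)).
apply: (indB (f @: I)).
- by apply/subsetP => _ /imsetP[k _ ->]; apply: enum_valP.
- by rewrite imset_eq0.
(* Weights are transported by inverting [f]; the default 0 is only taken outside the image of
   [f]. *)
exists (fun i => if [pick k | f k == i] is Some k then a k else 0).
  move=> _ /imsetP[k kI ->].
  by case: pickP => [k' /eqP/fI ->|/(_ k)/eqP//]; apply: aA.
rewrite big_imset /=; last by move=> x y _ _ /fI.
rewrite -[RHS]sa; apply: eq_bigr => k _.
by case: pickP => [k' /eqP/fI ->|/(_ k)/eqP//]; rewrite S'E.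
Qed.

Lemma mulrz_modz (G : zmodType) (n : nat) (x : G) (c : int) :
  x *+ n = 0 -> x *~ (c %% n)%Z = x *~ c.
Proof.
by move=> xn; rewrite /modz mulrzBr mulrC mulrzA -pmulrn xn mul0rz subr0.
Qed.

(** Terms with coefficient divisible by [n] vanish, and the other coefficients have nonzero residues
    modulo [n]. *)
Lemma is_weighted_sum_support (G : finZmodType) (n : nat) (S : seq G)
    (c : 'I_(size S) -> int) :
  (0 < n)%N -> (forall x : G, x *+ n = 0) ->
  \sum_(i < size S) S`_i *~ c i = 0 ->
  is_weighted_sum [pred a : int | 1 <= a <= n%:Z - 1]
    [set i : 'I_(size S) | ~~ (n %| c i)%Z] 0.
Proof.
move=> n0 Gn sc.
exists (fun i => (c i %% n)%Z).
  move=> i; rewrite !inE => ndvd.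
  have nz : n%:Z != 0 by rewrite eqz_nat -lt0n.
  rewrite -gtz0_ge1 lt_def modz_ge0 // andbT.
  have := ltz_mod (c i) nz; rewrite lerBrDr lezD1 ger0_norm // => ->.
  by rewrite andbT; apply: contra ndvd => /eqP/dvdz_mod0P.
rewrite -[RHS]sc [RHS](bigID (mem [set i | ~~ (n %| c i)%Z])) /=.
rewrite [X in _ = _ + X]big1 ?addr0; last first.
  move=> i; rewrite inE negbK => /dvdz_mod0P ci0.
  by rewrite -(mulrz_modz _ n) // ci0.
by apply: eq_bigr => i _; rewrite mulrz_modz.
Qed.

Lemma relation_outside (G : finZmodType) (n : nat) (S : seq G)
    (B : {set 'I_(size S)}) (j : 'I_(size S)) :
  independent G [pred a : int | 1 <= a <= n%:Z - 1] S B ->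
  ~ independent G [pred a : int | 1 <= a <= n%:Z - 1] S (j |: B) ->
  exists c : 'I_(size S) -> int,
    [/\ \sum_(i < size S) S`_i *~ c i = 0, ~~ (n %| c j)%Z
      & forall i, i \notin B -> i != j -> c i = 0].
Proof.
move=> indB /existsNP[I /not_implyP[IjB /not_implyP[I0 /contrapT[a aA sa]]]].
(* Otherwise [I] would lie in [B], against independence. *)
have jI : j \in I.
  apply/negPn/negP => jI; apply: (indB I) => //; last by exists a.
  apply/subsetP => i iI; have := subsetP IjB i iI.
  by rewrite in_setU1 => /predU1P[ij|//]; rewrite -ij iI in jI.
exists (fun i => if i \in I then a i else 0); split.
- rewrite -[RHS]sa [RHS]big_mkcond; apply: eq_bigr => i _.
  by case: ifP.
- rewrite jI; have /andP[a1 an] := aA j jI.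
  have a0 : 0 < a j by rewrite gtz0_ge1.
  apply/negP => /dvdz_mod0P; rewrite modz_small; first by move=> e; rewrite e in a0.
  by rewrite ltW //= -lezD1 -lerBrDr.
- move=> i iB ij; case: ifP => // /(subsetP IjB).
  by rewrite !inE (negPf ij) (negPf iB).
Qed.

Lemma weighted_count_ge (G : finZmodType) (n : nat) (S : seq G)
    (B : {set 'I_(size S)}) :
  (0 < n)%N -> (forall x : G, x *+ n = 0) ->
  independent G [pred a : int | 1 <= a <= n%:Z - 1] S B ->
  (forall j, j \notin B ->
    ~ independent G [pred a : int | 1 <= a <= n%:Z - 1] S (j |: B)) ->
  (2 ^ (size S - #|B|) <=
    weighted_count [pred a : int | (1 <= a <= n%:Z - 1)%R] 0%R S)%N.
Proof.
move=> n0 Gn indB maxB.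
have /choice[c cP] (j : 'I_(size S)) : exists c : 'I_(size S) -> int,
    j \notin B -> [/\ \sum_(i < size S) S`_i *~ c i = 0, ~~ (n %| c j)%Z
      & forall i, i \notin B -> i != j -> c i = 0].
  have [jB|jB] := boolP (j \in B); first by exists (fun=> 0).
  by have [c cP] := relation_outside _ _ _ _ _ indB (maxB j jB); exists c.
have <- : #|powerset (~: B)| = (2 ^ (size S - #|B|))%N.
  by rewrite card_powerset cardsCs setCK card_ord.
(* It suffices that removing [B] maps the zero-sum index sets onto all subsets of the complement of
   [B]. *)
apply: leq_trans (leq_imset_card (fun I => I :\: B) _).
apply/subset_leq_card/subsetP => T; rewrite powersetE => TB.
have TnB j : j \in T -> j \notin B by move/(subsetP TB); rewrite inE.
pose d i := \sum_(j in T) c j i.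
apply/imsetP; exists [set i | ~~ (n %| d i)%Z].
  rewrite inE; apply/asboolP; apply: is_weighted_sum_support => //.
  under eq_bigr do rewrite /d mulrz_sumr.
  by rewrite exchange_big big1 //= => j /TnB /cP[].
apply/setP => i; rewrite !inE; have [iB|iB] := boolP (i \in B) => /=.
  by apply/negP => /TnB; rewrite iB.
(* Outside [B], only [c i] can be nonzero at [i], so [d i] is [c i i] if [i] is in [T] and 0
   otherwise. *)
have [iT|iT] := boolP (i \in T).
  rewrite /d (bigD1 i) //= big1 ?addr0; first by case: (cP i iB) => _ ->.
  by move=> j /andP[/TnB /cP[_ _ cj] ji]; rewrite cj // eq_sym.
rewrite /d big1 ?dvdz0 // => j jT; have [_ _ cj] := cP j (TnB j jT).
by rewrite cj //; apply: contraNneq iT => ->.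
Qed.

Theorem theorem3p4 (G : finZmodType) (n : nat)
  (n_exp : n = exponent [set: G]) (n_ge2 : (2 <= n)%N) :
  zero_complete G [pred a : int | 1 <= a <= n%:Z - 1].
Proof.
move=> S; set A := [pred a : int | _].
have n0 : (0 < n)%N by apply: ltnW.
have Gn (x : G) : x *+ n = 0 by rewrite -FinRing.zmodXgE n_exp expg_exponent ?inE.
(* This is where [n_ge2] enters: [A] is nonempty, so [davenport G A] is a genuine minimum and not
   the default 0. *)
have A1 : (1 : int) \in A by rewrite !inE lexx lerBrDr lez_nat.
have [dav _] := davenportP G A1.
have [B /maxsetP[/asboolP indB maxB] _] :=
  @maxset_exists _ (fun B => `[< independent G A S B >]) set0
    (asboolT (independent0 G A S)).
have ltB := independent_card_lt _ _ _ _ _ dav indB.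
have leN : (2 ^ (size S - #|B|) <= weighted_count A 0%R S)%N.
  apply: weighted_count_ge => // j jB indjB; move: jB.
  by rewrite -(maxB (j |: B)) ?subsetUr ?setU11 //; apply/asboolP.
apply: (@le_trans _ _ (2 ^+ (size S - #|B|))); last by rewrite -natrX ler_nat.
rewrite -[_ ^+ _]/(2 ^ Posz _) -subzn; last first.
  by rewrite -[leqRHS]card_ord max_card.
apply: ler_weXz2l; first by rewrite ler1n.
(* The comparison of exponents amounts to [#|B| + 1 <= davenport G A], which is [ltB]. *)
by rewrite -addrA lerD2l lerNr opprD opprK lerBrDr lez_nat addn1.
Qed.
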